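(* Let $T$ be a complete theory with monster model $\mathfrak{C}$, let $\varphi(\overline{x};\overline{y})$ be a partitioned formula, and let $N$ be a positive integer such that for every $B\subseteq\mathfrak{C}^{\mathrm{lg}(\overline{y})}$ with $|B|=N$ we have $|S_\varphi(B)|\le\frac{N(N+1)}{2}$. Then $\varphi$ has UDTFS.
   Context: Formulas are $\emptyset$-definable. For $B \subseteq \mathfrak{C}^{\mathrm{lg}(\overline{y})}$, $S_\varphi(B)$ is the set of $\varphi$-types over $B$: maximal consistent sets of formulas $\varphi(\overline{x};\overline{b})$ or $\neg\varphi(\overline{x};\overline{b})$ with $\overline{b}\in B$. A formula $\psi(\overline{y})$ (possibly with parameters) defines $p\in S_\varphi(B)$ if for all $\overline{b}\in B$, $\models\psi(\overline{b})$ iff $\varphi(\overline{x};\overline{b})\in p$. $\varphi(\overline{x};\overline{y})$ has UDTFS if there is a formula $\psi(\overline{y}; \overline{z}_0,\dots,\overline{z}_{k-1})$ such that for every finite set $B$ of $\mathrm{lg}(\overline{y})$-tuples with $|B|\ge 2$ and every $p\in S_\varphi(B)$ there are $\overline{c}_0,\dots,\overline{c}_{k-1}\in B$ such that $\psi(\overline{y};\overline{c}_0,\dots,\overline{c}_{k-1})$ defines $p$. *)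

(* Defs.v *)
Set Warnings "-notation-overridden,-notation-incompatible-prefix".
From mathcomp Require Export all_boot.
From mathcomp Require Export boolp classical_sets functions cardinality.

Set Implicit Arguments.
Unset Strict Implicit.
Unset Printing Implicit Defensive.

Local Open Scope classical_set_scope.
Local Open Scope card_scope.

Record language := Language {
  funsym : nat -> Type;
  relsym : nat -> Type
}.

(* [formula L V] is the type of formulas whose free variables lie in [V]. A
   quantifier binds the variable [None] of a formula over [option V]. *)
Inductive term (L : language) (V : Type) : Type :=
| Var of V
| App (r : nat) of funsym L r & 'I_r -> term L V.

Inductive formula (L : language) (V : Type) : Type :=
| Eq of term L V & term L V
| Rel (r : nat) of relsym L r & 'I_r -> term L V
| Not of formula L V
| And of formula L V & formula L V
| Ex of formula L (option V).

Notation sentence L := (formula L void).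

Fixpoint rename_term L (V W : Type) (s : V -> W) (t : term L V) : term L W :=
  match t with
  | Var x => Var L (s x)
  | App r f ts => App f (fun i => rename_term s (ts i))
  end.

Fixpoint rename L (V W : Type) (s : V -> W) (chi : formula L V) :
    formula L W :=
  match chi with
  | Eq t u => Eq (rename_term s t) (rename_term s u)
  | Rel r R ts => Rel R (fun i => rename_term s (ts i))
  | Not c => Not (rename s c)
  | And c d => And (rename s c) (rename s d)
  | Ex c => Ex (rename (omap s) c)
  end.

Record structure (L : language) := Structure {
  carrier :> Type;
  carrier_inhabited : inhabited carrier;
  func_interp : forall r, funsym L r -> r.-tuple carrier -> carrier;
  rel_interp : forall r, relsym L r -> r.-tuple carrier -> Prop
}.

Fixpoint eval L (M : structure L) (V : Type) (v : V -> M) (t : term L V) : M :=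
  match t with
  | Var x => v x
  | App r f ts => func_interp f [tuple eval v (ts i) | i < r]
  end.

Fixpoint sat L (M : structure L) (V : Type) (chi : formula L V)
    (v : V -> M) : Prop :=
  match chi with
  | Eq t u => eval v t = eval v u
  | Rel r R ts => rel_interp R [tuple eval v (ts i) | i < r]
  | Not c => ~ sat c v
  | And c d => sat c v /\ sat d v
  | Ex c => exists a : M, sat c (oapp v a)
  end.

Definition holds L (M : structure L) (s : sentence L) : Prop :=
  sat (M := M) s (of_void M).

Definition models L (M : structure L) (T : set (sentence L)) : Prop :=
  forall s, T s -> holds M s.

Definition entails L (T : set (sentence L)) (s : sentence L) : Prop :=
  forall M : structure L, models M T -> holds M s.

Definition complete_theory L (T : set (sentence L)) : Prop :=
  (exists M : structure L, models M T) /\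
  forall s, entails T s \/ entails T (Not s).

Definition elementary_embedding L (M D : structure L) (e : M -> D) : Prop :=
  forall (r : nat) (chi : formula L 'I_r) (v : 'I_r -> M),
    sat chi v <-> sat chi (e \o v).

Definition join (V W X : Type) (u : V -> X) (v : W -> X) (s : V + W) : X :=
  match s with inl x => u x | inr y => v y end.

(* An element of [formula L (V + M)] is a formula with variables in [V] and
   parameters in [M]. [inst theta b] is theta(x; b), which has the parameters
   [b] in place of the variables [W]. *)
Definition inst L (M : structure L) (V W : Type)
    (theta : formula L (V + W)) (b : W -> M) : formula L (V + M) :=
  rename (join inl (inr \o b)) theta.

Definition over L (M : structure L) (V : Type) (A : set M) :
    set (formula L (V + M)) :=
  [set chi | exists (r : nat) (theta : formula L (V + 'I_r)) (a : 'I_r -> M),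
     (forall i, A (a i)) /\ chi = inst theta a].

(* Consistency with the elementary diagram of [M] *)
Definition consistent L (M : structure L) (V : Type)
    (p : set (formula L (V + M))) : Prop :=
  exists (D : structure L) (e : M -> D) (a : V -> D),
    elementary_embedding e /\ forall chi, p chi -> sat chi (join a e).

Definition realized L (M : structure L) (V : Type)
    (p : set (formula L (V + M))) : Prop :=
  exists a : V -> M, forall chi, p chi -> sat chi (join a id).

(* The type [kappa] stands for its cardinality: [A] is small if |A| < kappa. *)
Definition small (kappa X : Type) (A : set X) : Prop :=
  ~ ([set: kappa] #<= A).

Definition saturated L (kappa : Type) (M : structure L) : Prop :=
  forall A : set M, small kappa A ->
  forall p : set (formula L (unit + M)),
    p `<=` over A -> consistent p -> realized p.

Definition automorphism L (M : structure L) (g : M -> M) : Prop :=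
  [/\ bijective g,
      forall r (f : funsym L r) (a : r.-tuple M),
        g (func_interp f a) = func_interp f (map_tuple g a)
    & forall r (R : relsym L r) (a : r.-tuple M),
        rel_interp R a <-> rel_interp R (map_tuple g a)].

Definition elementary_on L (M : structure L) (A : set M) (f : M -> M) : Prop :=
  forall (r : nat) (chi : formula L 'I_r) (v : 'I_r -> M),
    (forall i, A (v i)) -> (sat chi v <-> sat chi (f \o v)).

Definition strongly_homogeneous L (kappa : Type) (M : structure L) : Prop :=
  forall A : set M, small kappa A ->
  forall f : M -> M, elementary_on A f ->
  exists g : M -> M, automorphism g /\ forall a, A a -> g a = f a.

(* The number of sentences is |L| + aleph_0, so the second condition is
   kappa > |L| + aleph_0. *)
Definition monster_model L (kappa : Type) (T : set (sentence L))
    (C : structure L) : Prop :=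
  [/\ models C T, small kappa [set: sentence L],
      saturated kappa C & strongly_homogeneous kappa C].

Section PhiTypes.
Variables (L : language) (C : structure L) (m n : nat).
Variable phi : formula L ('I_m + 'I_n).

Definition phi_at (b : n.-tuple C) : formula L ('I_m + C) := inst phi (tnth b).

Definition phi_formulas (B : set (n.-tuple C)) : set (formula L ('I_m + C)) :=
  [set chi | exists b, B b /\ (chi = phi_at b \/ chi = Not (phi_at b))].

Definition phi_types (B : set (n.-tuple C)) :
    set (set (formula L ('I_m + C))) :=
  [set p | [/\ p `<=` phi_formulas B, consistent p &
     forall q, q `<=` phi_formulas B -> consistent q -> p `<=` q -> q = p]].

(* In psi(y; z_0, ..., z_(k-1)) the variables y are indexed by ['I_n], and the
   variable (j, i) is the i-th entry of z_j. *)
Definition defines k (psi : formula L ('I_n + 'I_k * 'I_n))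
    (c : 'I_k -> n.-tuple C) (B : set (n.-tuple C))
    (p : set (formula L ('I_m + C))) : Prop :=
  forall b, B b ->
    (sat psi (join (tnth b) (fun z => tnth (c z.1) z.2)) <-> p (phi_at b)).

Definition UDTFS : Prop :=
  exists (k : nat) (psi : formula L ('I_n + 'I_k * 'I_n)),
  forall B : set (n.-tuple C), finite_set B -> `I_2 #<= B ->
  forall p, phi_types B p ->
  exists c : 'I_k -> n.-tuple C, (forall j, B (c j)) /\ defines psi c B p.

End PhiTypes.

(* Main.v *)
(* Fix a finite B and a type p over B, and encode every type over B by the set of
   elements of B at which it disagrees with p; these sets form a family F that
   contains set0. The profile of y over Y records which truth values of phi at Y
   and y are jointly realized. If y and z have the same profile over Y but opposite
   truth values in p, then they are antitwins: whenever a member of F misses one of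
   them, some member of F with the same trace on Y contains the other. So a set Y
   of bounded size over which there are no antitwins determines p: the truth value
   at y is a function of the profile of y over Y, and this function is coded by
   equalities between two distinct elements of B.

   To find such a Y, consider the sets of at most K elements, each with an antitwin
   over V, and let Y be one for which the fewest members of F vanish on V and Y. If
   antitwins over the union of V and Y remain, then replacing a part J of Y by a set
   Z of at most as many elements, among them such an antitwin, cannot lower that
   number; hence some member of F vanishes on V, on Y minus J and on Z, but meets J.
   For singletons J this makes {c} a trace for every c in Y. By a Ramsey argument,
   either all pairs from some N-subset of Y are traces too, and this subset has
   1 + N + N (N - 1) / 2 traces, or J can be a large subset of Y that contains no
   trace with several elements. In the latter case the member of F meets V and Y in a
   single point c of J, and the antitwins in Z allow us to redirect it to later
   points. Iterating gives c_1, ..., c_N such that members of F whose first point is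
   c_i have any prescribed next point, or none; these are again 1 + N (N + 1) / 2
   traces, one more than allowed. *)
Require Import Defs.
Set Implicit Arguments.
Unset Strict Implicit.
Unset Printing Implicit Defensive.

Local Open Scope nat_scope.

Section Combinatorics.
Import mathcomp.boot.fintype mathcomp.boot.finset.

Lemma pigeonhole_fiber (T U : finType) (D : {set T}) (P : {set U})
    (g : T -> U) (k : nat) :
  {in D, forall x, g x \in P} -> #|P| * k < #|D| ->
  exists2 u, u \in P & k < #|[set x in D | g x == u]|.
Proof.
move=> gP lt; apply/exists_inP; apply: contraLR lt => /exists_inPn small_fibers.
rewrite -leqNgt -sum1_card (partition_big g (mem P)) //= -sum_nat_const.
apply: leq_sum => u /small_fibers; rewrite -leqNgt; apply: leq_trans.
by rewrite -sum1_card; apply: eq_leq; apply: eq_bigl => x; rewrite !inE.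
Qed.

Lemma cover_by_tuple (T : finType) (A : {set T}) (K : nat) (x0 : T) :
  #|A| <= K -> exists c : 'I_K -> T, {in A, forall x, exists k, x = c k}.
Proof.
move=> AK; exists (fun k => nth x0 (enum A) k) => x.
rewrite -mem_enum => /(nthP x0)[k ks <-]; rewrite -cardE in ks.
by exists (Ordinal (leq_trans ks AK)).
Qed.

Section SetFamilies.
Variable T : finType.
Implicit Types (A B J X Y e t : {set T}) (E F : {set {set T}}).

Lemma disjoint_setUr A B X : [disjoint A & B :|: X] = [disjoint A & B] && [disjoint A & X].
Proof. by rewrite -!setI_eq0 setIUr setU_eq0. Qed.

Lemma disjoint_setU1r x A B : [disjoint A & x |: B] = (x \notin A) && [disjoint A & B].
Proof. by rewrite disjoint_setUr disjoint_sym disjoints1. Qed.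

Lemma card_draws_lt A (k : nat) :
  #|[set B : {set T} | B \subset A & #|B| < k]| = \sum_(i < k) 'C(#|A|, i).
Proof.
elim: k => [|k IHk].
  by rewrite big_ord0 eq_card0 // => B; rewrite !inE andbF.
rewrite big_ord_recr -IHk -cards_draws -(cardsID [set B : {set T} | #|B| < k]) /=.
congr (_ + _); apply: eq_card => B; rewrite !inE.
  by rewrite -andbA; congr (_ && _); rewrite ltnS andb_idl // => /ltnW.
by rewrite andbC -andbA ltnS -leqNgt -eqn_leq.
Qed.

Definition traces F A : {set {set T}} := [set f :&: A | f in F].

Lemma traces_restrict F A X t : A \subset X -> t \in traces F X -> t :&: A \in traces F A.
Proof.
by move=> AX /imsetP[f Ff ->]; apply/imsetP; exists f; rewrite // -setIA (setIidPr AX).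
Qed.

Lemma card_traces_pairs F A :
  set0 \in F -> {in A &, forall a b, [set a; b] \in traces F A} ->
  'C(#|A|.+1, 2) < #|traces F A|.
Proof.
move=> F0 pairs.
have -> : 'C(#|A|.+1, 2).+1 = #|[set B : {set T} | B \subset A & #|B| < 3]|.
  by rewrite card_draws_lt !big_ord_recl big_ord0 bin0 addn0 binS addnC.
apply: subset_leq_card; apply/subsetP=> B; rewrite inE => /andP[BA].
rewrite ltnS leq_eqVlt ltnS leq_eqVlt ltnS leqn0 cards_eq0.
case/or3P=> [/cards2P[a [b [_ defB]]] | /cards1P[a defB] | /eqP->].
- by rewrite defB; apply: pairs; apply: (subsetP BA); rewrite defB !inE eqxx ?orbT.
- have aA : a \in A by rewrite -sub1set -defB.
  by rewrite defB -[[set a]]setUid; apply: pairs.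
- by rewrite -(set0I A); apply: imset_f.
Qed.

Definition independent E J : bool := [forall e in E, (e \subset J) ==> (#|e| <= 1)].

Lemma independentP E J :
  reflect {in E, forall e, e \subset J -> #|e| <= 1} (independent E J).
Proof. by apply: (iffP forall_inP) => ind e Ee; apply/implyP; apply: ind. Qed.

Lemma independent1 E x : independent E [set x].
Proof. by apply/independentP=> e _ /subset_leq_card; rewrite cards1. Qed.

Lemma dependent_setU1 E J y :
  independent E J -> ~~ independent E (y |: J) ->
  exists e x, [/\ e \in E, e \subset y |: J, y \in e & x \in e :&: J].
Proof.
move=> indJ dep; have yJ : y \notin J.
  by apply: contra dep => yJ; rewrite (setUidPr _) ?sub1set.
move: dep; rewrite negb_forall_in => /exists_inP[e Ee].
rewrite negb_imply -ltnNge => /andP[eyJ e_gt1].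
have ye : y \in e.
  apply: contraLR e_gt1 => ye; rewrite -leqNgt; move/independentP: indJ; apply=> //.
  by rewrite -(setU1K yJ) subsetD1 eyJ.
have [x xe xy] : exists2 x, x \in e & x != y.
  have [u [v [ue ve uv]]] := card_gt1P e_gt1.
  by have [uy|] := eqVneq u y; [exists v; rewrite // -uy eq_sym | exists u].
exists e, x; split=> //; rewrite inE xe /=.
by have := subsetP eyJ _ xe; rewrite !inE (negbTE xy).
Qed.

Lemma common_partner E Y (j k : nat) :
  (forall J, J \subset Y -> independent E J -> #|J| < j) -> j * k.+1 <= #|Y| ->
  exists a X, [/\ a \in Y, a \notin X, X \subset Y, k <= #|X| &
    {in X, forall y, exists2 e, e \in E & e \subset Y /\ e :&: (a |: X) = [set a; y]}].
Proof.
move=> small leY.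
have [J /maxsetP[/andP[JY indJ] maxJ] _] :
    {J | maxset (fun J => (J \subset Y) && independent E J) J & set0 \subset J}.
  apply: maxset_exists; rewrite sub0set; apply/independentP=> e _.
  by rewrite subset0 => /eqP->; rewrite cards0.
have edge y : exists ea : {set T} * T, y \in Y :\: J ->
    [/\ ea.1 \in E, ea.1 \subset y |: J, y \in ea.1 & ea.2 \in ea.1 :&: J].
  have [|_] := boolP (y \in Y :\: J); last by exists (set0, y).
  rewrite inE => /andP[yJ yY]; have : ~~ independent E (y |: J).
    apply: contra yJ => ind; rewrite -(maxJ (y |: J)) ?setU11 ?subsetUr //.
    by rewrite subUset sub1set yY JY.
  by case/(dependent_setU1 indJ)=> e [x exP]; exists (e, x).
have [ea eaP] := fin_all_exists edge.
have [||a aJ kX] := @pigeonhole_fiber _ _ (Y :\: J) J (fun y => (ea y).2) k.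
- by move=> y /eaP[_ _ _ /setIP[]].
- rewrite cardsD (setIidPr JY) ltn_subRL -mulnS; apply: leq_trans leY.
  by rewrite ltn_pmul2r // small.
exists a, [set y in Y :\: J | (ea y).2 == a]; split.
- exact: subsetP aJ.
- by rewrite !inE aJ.
- by apply/subsetP=> y; rewrite !inE => /andP[/andP[]].
- exact: ltnW.
move=> y /setIdP[yYJ /eqP ya]; have [Ee eyJ ye] := eaP y yYJ; rewrite ya => /setIP[ae _].
have [yY _] := setDP yYJ; exists (ea y).1 => //; split.
  by apply: subset_trans eyJ _; rewrite subUset sub1set yY.
apply/setP=> x; rewrite in_setI !in_setU1 in_set1.
have [->|xa /=] := eqVneq x a; first by rewrite ae.
have [->|xy /=] := eqVneq x y; first by rewrite ye inE yYJ ya eqxx.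
apply/negbTE/negP=> /andP[/(subsetP eyJ) + /setIdP[/setDP[_ xJ] _]].
by rewrite !inE (negbTE xy) (negbTE xJ).
Qed.

End SetFamilies.

Lemma independent_or_pairs (j r : nat) : exists K : nat,
  forall (T : finType) (E : {set {set T}}) (Y : {set T}), K <= #|Y| ->
  (exists J : {set T}, [/\ J \subset Y, j <= #|J| & independent E J]) \/
  (exists A : {set T}, [/\ A \subset Y, #|A| = r &
     {in A &, forall a b, a != b ->
        exists2 e, e \in E & e \subset Y /\ e :&: A = [set a; b]}]).
Proof.
elim: r => [|r [K IHr]].
  exists 0 => T E Y _; right; exists set0; rewrite sub0set cards0; split=> // a b.
  by rewrite inE.
exists (j * K.+1) => T E Y leY.
have [|none] := pselect (exists J : {set T}, [/\ J \subset Y, j <= #|J| & independent E J]).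
  by left.
have {none}small (J : {set T}) : J \subset Y -> independent E J -> #|J| < j.
  by move=> JY indJ; rewrite ltnNge; apply/negP=> leJ; apply: none; exists J.
have [a [X [aY aX XY leX partner]]] := common_partner small leY.
have [[J [JX leJ indJ]]|[A [AX Ar pairs]]] := IHr T E X leX.
  by left; exists J; split=> //; apply: subset_trans XY.
have partnerA b : b \in A ->
    exists2 e, e \in E & e \subset Y /\ e :&: (a |: A) = [set a; b].
  move=> bA; have [e Ee [eY eX]] := partner b (subsetP AX _ bA).
  exists e => //; split=> //; rewrite -(setIidPr (setUS [set a] AX)) setIA eX.
  by apply/setIidPl; rewrite subUset !sub1set !inE eqxx bA orbT.
right; exists (a |: A); split.
- by rewrite subUset sub1set aY (subset_trans AX).
- by rewrite cardsU1 Ar (contra (subsetP AX a) aX).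
move=> b c; rewrite !in_setU1 => /predU1P[->|bA] /predU1P[->|cA] bc.
- by rewrite eqxx in bc.
- exact: partnerA.
- by rewrite [[set b; a]]setUC; apply: partnerA.
have [e Ee [eX eA]] := pairs b c bA cA bc; exists e => //; split.
  exact: subset_trans XY.
rewrite setIUr eA; apply/setUidPr; apply/subsetP=> x /setIP[xe /set1P xa].
by rewrite -xa (subsetP eX _ xe) in aX.
Qed.

Section Antitwins.
Variables (T : finType) (F : {set {set T}}).
Implicit Types (A J V W Y Z f g : {set T}) (c y z : T) (s : seq T).

Definition vanishing V : {set {set T}} := [set f in F | [disjoint f & V]].

Definition enforces V z y : bool :=
  [forall f in F, (z \notin f) ==>
    [exists g in F, (g :&: V == f :&: V) && (y \in g)]].

Definition antitwins V y z : bool := enforces V y z && enforces V z y.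

Definition antitwinned V : {set T} := [set y | [exists z, antitwins V y z]].

Lemma enforcesP V z y :
  reflect {in F, forall f, z \notin f ->
             exists2 g, g \in F & g :&: V = f :&: V /\ y \in g}
          (enforces V z y).
Proof.
apply: (iffP forall_inP) => zy f Ff; last first.
  apply/implyP=> /(zy f Ff)[g Fg [gV yg]]; apply/exists_inP.
  by exists g; rewrite // gV eqxx.
by move/implyP: (zy f Ff) => /[apply]/exists_inP[g Fg /andP[/eqP]]; exists g.
Qed.

Lemma enforces_sub V W z y : V \subset W -> enforces W z y -> enforces V z y.
Proof.
move=> VW /enforcesP zy; apply/enforcesP=> f Ff /(zy f Ff)[g Fg [gW yg]].
by exists g; rewrite // -(setIidPr VW) !setIA gW.
Qed.

Lemma antitwinned_sub V W : V \subset W -> antitwinned W \subset antitwinned V.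
Proof.
move=> VW; apply/subsetP=> y; rewrite !inE => /existsP[z /andP[zy yz]].
by apply/existsP; exists z; rewrite /antitwins !(enforces_sub VW).
Qed.

Lemma vanishing_sub V W : V \subset W -> vanishing W \subset vanishing V.
Proof.
move=> VW; apply/subsetP=> f; rewrite !inE => /andP[-> /=].
exact: disjointWr.
Qed.

Lemma vanishing_setU1 c V f :
  (f \in vanishing (c |: V)) = (c \notin f) && (f \in vanishing V).
Proof. by rewrite !inE disjoint_setU1r andbCA. Qed.

(* [find [in f] s'] is the index of the first point of [s'] in [f], and it is
   [size s'] when [f] misses [s']. *)
Fixpoint branching V s : Prop :=
  if s is c :: s' then
    (forall j, j <= size s' ->
       exists2 f, f \in vanishing V & c \in f /\ find [in f] s' = j) /\
    branching (c |: V) s'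
  else True.

Lemma branching_sub V W s : V \subset W -> branching W s -> branching V s.
Proof.
elim: s V W => //= c s IHs V W VW [steps /IHs branch]; split.
  by move=> j /steps[f /(subsetP (vanishing_sub VW)) Ff cf]; exists f.
by apply: branch; apply: setUS.
Qed.

Lemma branching_uniq V s : branching V s -> uniq s.
Proof.
elim: s V => //= c s IHs V [steps /IHs ->]; rewrite andbT.
have [f _ [cf]] := steps (size s) (leqnn _).
apply: contra_eqN => cs; rewrite ltn_eqF // -has_find; apply/hasP.
by exists c.
Qed.

Hypothesis F0 : set0 \in F.

Lemma card_traces_branching V s :
  branching V s -> 'C((size s).+1, 2) < #|traces (vanishing V) [set x in s]|.
Proof.
elim: s V => [|c s IHs] V /=.
  move=> _; apply/card_gt0P; exists (set0 :&: [set x in [::]]); apply: imset_f.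
  by rewrite inE F0 -setI_eq0 set0I eqxx.
case=> steps /IHs card_tail; set A := [set x in c :: s].
have step (j : 'I_(size s).+1) :
    exists f, [/\ f \in vanishing V, c \in f & find [in f] s = j].
  by have [f Ff []] := steps j (ltn_ord j); exists f.
have [g gP] := fin_all_exists step.
have g_inj : injective (fun j => g j :&: A).
  move=> i j /setP gij; apply: val_inj => /=.
  have [_ _ <-] := gP i; have [_ _ <-] := gP j; apply: eq_in_find => x xs.
  by have := gij x; rewrite !inE xs orbT !andbT.
set X := traces _ _ in card_tail; set Y := [set g j :&: A | j : 'I_(size s).+1].
have cardY : #|Y| = (size s).+1 by rewrite card_imset ?card_ord.
have disXY : [disjoint X & Y].
  apply/pred0P=> t /=; apply/andP=> -[/imsetP[f + ->] /imsetP[j _ /setP/(_ c)]].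
  have [_ cg _] := gP j; rewrite vanishing_setU1 => /andP[/negbTE cf _].
  by rewrite !inE cf cg eqxx.
rewrite binS bin1 -[X in _ + X]cardY -addSn.
apply: leq_trans (leq_add card_tail (leqnn _)) _.
rewrite -(eqP (etrans (leq_card_setU X Y).2 disXY)); apply: subset_leq_card.
rewrite subUset; apply/andP; split; apply/subsetP=> t /imsetP[].
  move=> f; rewrite vanishing_setU1 => /andP[cf Ff] ->{t}; apply/imsetP; exists f => //.
  apply/setP=> x; rewrite !inE; case: eqP => //= ->.
  by rewrite (negbTE cf) !andFb.
by move=> j _ ->{t}; apply: imset_f; have [] := gP j.
Qed.

Definition steers V Z s : Prop :=
  {in F, forall f, [disjoint f & Z] -> forall j, j <= size s ->
     exists2 g, g \in F & g :&: V = f :&: V /\ find [in g] s = j}.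

Lemma steers_cons V W Z c z s :
  c |: V \subset W -> antitwins V c z -> steers W Z s ->
  steers V (c |: (z |: Z)) (c :: s).
Proof.
rewrite subUset sub1set => /andP[cW VW] /andP[_ /enforcesP zc] steer f Ff.
rewrite !disjoint_setU1r => /and3P[cf zf fZ] [_|j] /=.
  by have [g Fg [gV cg]] := zc f Ff zf; exists g; rewrite // cg.
rewrite ltnS => /(steer f Ff fZ)[g Fg [gW <-]]; exists g => //; split.
  by rewrite -(setIidPr VW) !setIA gW.
by have /setP/(_ c) := gW; rewrite !inE cW !andbT (negbTE cf) => ->.
Qed.

Lemma branching_cons V W Z c f s :
  c |: V \subset W -> c \notin V -> f \in F -> f :&: W = [set c] -> [disjoint f & Z] ->
  steers W Z s -> branching W s -> branching V (c :: s).
Proof.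
move=> cVW cV Ff fW fZ steer branch; split; last exact: branching_sub branch.
move: cVW; rewrite subUset sub1set => /andP[cW VW].
move=> j /(steer f Ff fZ)[g Fg [gW gj]]; rewrite fW in gW; exists g; last first.
  by split=> //; have /setP/(_ c) := gW; rewrite !inE cW andbT eqxx.
by rewrite inE Fg -setI_eq0 -(setIidPr VW) setIA gW setI_eq0 disjoints1 cV.
Qed.

Lemma antitwinned_vanishing V y :
  y \in antitwinned V -> exists2 f, f \in vanishing V & y \in f.
Proof.
rewrite inE => /existsP[z /andP[_ /enforcesP/(_ _ F0)]].
rewrite inE set0I => /(_ isT)[f Ff [fV yf]]; exists f => //.
by rewrite inE Ff -setI_eq0 fV eqxx.
Qed.

Lemma antitwinned_notin V y : y \in antitwinned V -> y \notin V.
Proof.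
by case/antitwinned_vanishing=> f; rewrite inE => /andP[_ /disjointFr fV] /fV ->.
Qed.

Definition tightest V (K : nat) Y : Prop :=
  [/\ Y \subset antitwinned V, #|Y| <= K &
      forall Z, Z \subset antitwinned V -> #|Z| <= K ->
        #|vanishing (V :|: Y)| <= #|vanishing (V :|: Z)|].

Lemma exists_tightest V (K : nat) : exists Y, tightest V K Y.
Proof.
pose admissible Y := (Y \subset antitwinned V) && (#|Y| <= K).
have adm0 : admissible set0 by rewrite /admissible sub0set cards0.
case: (arg_minnP (fun Y => #|vanishing (V :|: Y)|) adm0) => Y /andP[YV YK] minY.
by exists Y; split=> // Z ZV ZK; apply: minY; rewrite /admissible ZV.
Qed.

Lemma tightest_exchange V (K : nat) Y J Z y :
  tightest V K Y -> J \subset Y -> Z \subset antitwinned V ->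
  #|Y :\: J| + #|Z| <= K -> y \in Z -> y \in antitwinned (V :|: Y) ->
  exists2 f, f \in F & f :&: (V :|: Y :|: Z) != set0 /\ f :&: (V :|: Y :|: Z) \subset J.
Proof.
move=> [YV YK minY] JY ZV card_swap yZ /antitwinned_vanishing[f fVY yf].
set W := Y :\: J :|: Z.
have WV : W \subset antitwinned V by rewrite subUset ZV (subset_trans (subsetDl Y J)).
have WK : #|W| <= K by apply: leq_trans (leq_card_setU _ _).1 card_swap.
have fVW : f \notin vanishing (V :|: W).
  by rewrite inE negb_and; apply/orP; right; apply/pred0Pn; exists y;
    rewrite /= !inE yf yZ !orbT.
have : ~~ (vanishing (V :|: W) \subset vanishing (V :|: Y)).
  have := minY W WV WK; rewrite leqNgt; apply: contra => sub.
  by apply/proper_card/properP; split=> //; exists f.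
case/subsetPn=> g; rewrite !inE => /andP[Fg gVW]; rewrite Fg -setI_eq0 /= => gVY.
exists g => //; split.
  by apply: contra gVY; rewrite setIUr setU_eq0 => /andP[].
apply/subsetP=> x /setIP[xg]; have := disjointFr gVW xg.
rewrite !inE => /negbT/norP[/negbTE-> /norP[xYJ /negbTE->]]; rewrite orbF /= => xY.
by rewrite xY andbT negbK in xYJ.
Qed.

Lemma tightest_card V (K : nat) Y :
  tightest V K Y -> antitwinned (V :|: Y) != set0 -> K <= #|Y|.
Proof.
move=> tight /set0Pn[y yVY]; rewrite leqNgt; apply/negP=> ltYK.
have yV := subsetP (antitwinned_sub (subsetUl V Y)) y yVY.
have [|||f _ [/negP f_neq0 fsub]] :=
    tightest_exchange tight (sub0set Y) (Z := [set y]) _ _ _ yVY.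
- by rewrite sub1set.
- by rewrite setD0 cards1 addn1.
- exact: set11.
by apply: f_neq0; rewrite -subset0.
Qed.

Lemma tightest_singleton V (K : nat) Y J Z :
  tightest V K Y -> antitwinned (V :|: Y) != set0 ->
  J \subset Y -> independent (traces F (V :|: Y)) J ->
  Z \subset antitwinned (V :|: Y) -> #|Z| < #|J| ->
  exists c f, [/\ c \in J, f \in F, f :&: (V :|: Y) = [set c] & [disjoint f & Z]].
Proof.
move=> tight /set0Pn[y yVY] JY /independentP indJ ZVY ltZJ; have [_ YK _] := tight.
have VY_V := antitwinned_sub (subsetUl V Y).
have [|||f Ff [f_neq0 fJ]] := tightest_exchange tight JY (Z := y |: Z) _ _ _ yVY.
- by rewrite subUset sub1set (subsetP VY_V _ yVY) (subset_trans ZVY).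
- rewrite cardsD (setIidPr JY); apply: leq_trans YK.
  rewrite -[leqRHS](subnK (subset_leq_card JY)) leq_add2l cardsU1.
  by apply: leq_trans ltZJ; rewrite -add1n leq_add ?leq_b1.
- exact: setU11.
have fVY : f :&: (V :|: Y :|: (y |: Z)) = f :&: (V :|: Y).
  apply/eqP; rewrite eqEsubset [X in _ && X]setIS ?subsetUl // andbT subsetI subsetIl.
  by apply: subset_trans fJ (subset_trans JY (subsetUr _ _)).
rewrite fVY in f_neq0 fJ; have /set0Pn[c cf] := f_neq0.
exists c, f; split=> //; first exact: subsetP fJ c cf.
  by apply/esym/eqP; rewrite eqEcard sub1set cf cards1; apply: indJ fJ; apply: imset_f.
apply/pred0P=> x /=; apply/andP=> -[xf xZ].
have : x \in f :&: (V :|: Y) by rewrite -fVY !inE xf xZ !orbT.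
by case/setIP=> _; apply/negP; apply: antitwinned_notin (subsetP ZVY x xZ).
Qed.

Lemma card_traces_tightest V (K : nat) Y A :
  tightest V K Y -> antitwinned (V :|: Y) != set0 -> A \subset Y ->
  {in A &, forall a b, a != b ->
     exists2 t, t \in traces F (V :|: Y) & t :&: A = [set a; b]} ->
  'C(#|A|.+1, 2) < #|traces F A|.
Proof.
move=> tight twinned AY pairs; apply: card_traces_pairs => // a b aA bA.
have AVY : A \subset V :|: Y := subset_trans AY (subsetUr V Y).
have [<-|ab] := eqVneq a b; last first.
  by have [t Ft <-] := pairs a b aA bA ab; apply: traces_restrict Ft.
have aY : [set a] \subset Y by rewrite sub1set (subsetP AY).
have [|c [f [/set1P-> Ff fa _]]] :=
    tightest_singleton tight twinned aY (independent1 _ a) (sub0set _).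
  by rewrite cards0 cards1.
have <- : [set a] :&: A = [set a; a] by rewrite setUid; apply/setIidPl; rewrite sub1set.
by apply: traces_restrict AVY _; rewrite -fa; apply: imset_f.
Qed.

Definition steered_branching V (r : nat) : Prop :=
  exists s Z, [/\ size s = r, branching V s, Z \subset antitwinned V,
                  #|Z| <= 2 * r & steers V Z s].

Lemma steered_branching0 V : steered_branching V 0.
Proof.
exists [::], set0; rewrite sub0set cards0; split=> // f Ff _ j.
by rewrite leqn0 => /eqP->; exists f.
Qed.

Lemma steered_branchingS V (K r : nat) Y J :
  tightest V K Y -> antitwinned (V :|: Y) != set0 ->
  J \subset Y -> 2 * r < #|J| -> independent (traces F (V :|: Y)) J ->
  steered_branching (V :|: Y) r -> steered_branching V r.+1.
Proof.
move=> tight twinned JY rJ indJ [s [Z [sr branch ZVY Zr steer]]].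
have [c [f [cJ Ff fc fZ]]] :=
    tightest_singleton tight twinned JY indJ ZVY (leq_ltn_trans Zr rJ).
have [YV _ _] := tight; have cY := subsetP JY c cJ; have cV := subsetP YV c cY.
have : c \in antitwinned V := cV; rewrite inE => /existsP[z cz].
have cVVY : c |: V \subset V :|: Y by rewrite subUset sub1set inE cY orbT subsetUl.
exists (c :: s), (c |: (z |: Z)); split.
- by rewrite /= sr.
- exact: (branching_cons cVVY (antitwinned_notin cV) Ff fc fZ steer branch).
- rewrite !subUset !sub1set cV (subset_trans ZVY) ?antitwinned_sub ?subsetUl // andbT.
  by rewrite inE; apply/existsP; exists c; rewrite /antitwins andbC.
- by rewrite !cardsU1 mulnS addnA leq_add // (leq_add (leq_b1 _) (leq_b1 _)).
- exact: steers_cons cVVY cz steer.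
Qed.

End Antitwins.

Lemma antitwin_free_or_steered_branching (N r : nat) : exists K : nat,
  forall (T : finType) (F : {set {set T}}) (V : {set T}), set0 \in F ->
  (forall A : {set T}, #|A| = N -> #|traces F A| <= 'C(N.+1, 2)) ->
  (exists2 Y : {set T}, #|Y| <= K & antitwinned F (V :|: Y) = set0) \/
  steered_branching F V r.
Proof.
elim: r => [|r [Kr IHr]]; first by exists 0 => T F V _ _; right; apply: steered_branching0.
have [Kp independent_or_pairsK] := independent_or_pairs (2 * r).+1 N.
exists (Kp + Kr) => T F V F0 bound.
have [Y tight] := exists_tightest F V Kp; have [_ YK _] := tight.
have [Y_free|twinned] := eqVneq (antitwinned F (V :|: Y)) set0.
  by left; exists Y; first exact: leq_trans YK (leq_addr _ _).
have YKp := tightest_card F0 tight twinned.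
have [[J [JY rJ indJ]]|[A [AY AN pairs]]] :=
    independent_or_pairsK T (traces F (V :|: Y)) Y YKp; last first.
  have := bound A AN; rewrite leqNgt -{1}AN (card_traces_tightest F0 tight twinned AY) //.
  by move=> a b aA bA /(pairs a b aA bA)[t Ft [_ tA]]; exists t.
have [[W WK W_free]|branchingVY] := IHr T F (V :|: Y) F0 bound.
  left; exists (Y :|: W); last by rewrite setUA.
  by apply: leq_trans (leq_card_setU _ _).1 (leq_add YK WK).
by right; apply: steered_branchingS tight twinned JY rJ indJ branchingVY.
Qed.

Lemma bounded_antitwin_free (N : nat) : exists K : nat,
  forall (T : finType) (F : {set {set T}}), set0 \in F ->
  (forall A : {set T}, #|A| = N -> #|traces F A| <= 'C(N.+1, 2)) ->
  exists2 Y : {set T}, #|Y| <= K & antitwinned F Y = set0.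
Proof.
have [K free_or_branching] := antitwin_free_or_steered_branching N N; exists K.
move=> T F F0 bound; have [[Y YK Y_free]|] := free_or_branching T F set0 F0 bound.
  by exists Y; rewrite // -[Y]set0U.
case=> s [Z [sN branch _ _ _]]; have := card_traces_branching F0 branch.
have sA : #|[set x in s]| = N by rewrite cardsE (card_uniqP (branching_uniq branch)).
rewrite sN ltnNge => /negP[]; apply: leq_trans (bound _ sA).
by apply/subset_leq_card/imsetS/subsetP=> f; rewrite inE => /andP[].
Qed.

End Combinatorics.

Section Definability.
Variable L : language.
Implicit Types (V W : Type) (M D : structure L).

Lemma eval_rename V W M (s : V -> W) (t : term L V) (v : W -> M) :
  eval v (rename_term s t) = eval (v \o s) t.
Proof.
elim: t => //= r f ts IH; congr func_interp; apply: eq_from_tnth => i.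
by rewrite !tnth_mktuple IH.
Qed.

Lemma sat_rename V W M (s : V -> W) (chi : formula L V) (v : W -> M) :
  sat (rename s chi) v <-> sat chi (v \o s).
Proof.
elim: chi W s v => {V} /= [V t u|V r P ts|V chi IH|V chi IH1 chi' IH2|V chi IH] W s v.
- by rewrite !eval_rename.
- have -> // : [tuple eval v (rename_term s (ts i)) | i < r] =
    [tuple eval (v \o s) (ts i) | i < r].
  by apply: eq_from_tnth => i; rewrite !tnth_mktuple eval_rename.
- by rewrite IH.
- by rewrite IH1 IH2.
- have oappE a : oapp v a \o omap s = oapp (v \o s) a by apply/funext; case.
  by split=> -[a sat_a]; exists a; move: sat_a; rewrite IH oappE.
Qed.

Definition definable V (P : forall M, (V -> M) -> Prop) : Prop :=
  exists chi : formula L V, forall M (v : V -> M), sat chi v <-> P M v.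

Lemma definable_ext V (P Q : forall M, (V -> M) -> Prop) :
  (forall M v, P M v <-> Q M v) -> definable P -> definable Q.
Proof. by move=> PQ [chi chiP]; exists chi => M v; rewrite chiP. Qed.

Lemma definable_sat V (chi : formula L V) : definable (fun M v => sat chi v).
Proof. by exists chi. Qed.

Lemma definable_rename V W (s : V -> W) (P : forall M, (V -> M) -> Prop) :
  definable P -> definable (fun M v => P M (v \o s)).
Proof. by move=> [chi chiP]; exists (rename s chi) => M v; rewrite sat_rename. Qed.

Lemma definable_eq V (x y : V) : definable (fun M v => v x = v y).
Proof. by exists (Eq (Var L x) (Var L y)). Qed.

Lemma definable_not V (P : forall M, (V -> M) -> Prop) :
  definable P -> definable (fun M v => ~ P M v).
Proof. by move=> [chi chiP]; exists (Not chi) => M v /=; rewrite chiP. Qed.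

Lemma definable_and V (P Q : forall M, (V -> M) -> Prop) :
  definable P -> definable Q -> definable (fun M v => P M v /\ Q M v).
Proof.
by move=> [chi chiP] [psi psiQ]; exists (And chi psi) => M v /=; rewrite chiP psiQ.
Qed.

Lemma definable_ex V (P : forall M, (option V -> M) -> Prop) :
  definable P -> definable (fun M v => exists a : M, P M (oapp v a)).
Proof.
move=> [chi chiP]; exists (Ex chi) => M v /=.
by split=> -[a /chiP]; exists a => //; apply/chiP.
Qed.

Lemma definable_True V : definable (fun M (v : V -> M) => True).
Proof.
exists (Ex (Eq (Var L None) (Var L None))) => M v; split=> // _.
by have [a] := carrier_inhabited M; exists a.
Qed.

Lemma definable_bool V (b : bool) : definable (fun M (v : V -> M) => b).
Proof.
case: b; first by apply: definable_ext (definable_True V).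
by apply: definable_ext (definable_not (definable_True V)) => M v; split.
Qed.

Lemma definable_imp V (P Q : forall M, (V -> M) -> Prop) :
  definable P -> definable Q -> definable (fun M v => P M v -> Q M v).
Proof.
move=> dP /definable_not dQ; apply: definable_ext (definable_not (definable_and dP dQ)).
move=> M v; split=> [notPnQ HP|PQ [HP nQ]]; last exact: nQ (PQ HP).
by apply: contrapT => nQ; apply: notPnQ.
Qed.

Lemma definable_iff V (P Q : forall M, (V -> M) -> Prop) :
  definable P -> definable Q -> definable (fun M v => P M v <-> Q M v).
Proof. by move=> dP dQ; apply: definable_and; apply: definable_imp. Qed.

Lemma definable_forall_fin (I : finType) V (P : I -> forall M, (V -> M) -> Prop) :
  (forall i, definable (P i)) -> definable (fun M v => forall i, P i M v).
Proof.
move=> dP; suff: definable (fun M v => forall i, i \in enum I -> P i M v).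
  by apply: definable_ext => M v; split=> allP i //; apply: allP; rewrite mem_enum.
elim: (enum I) => [|i s IH]; first by apply: definable_ext (definable_True V).
apply: definable_ext (definable_and (dP i) IH) => M v; split.
  by move=> [Pi allPs] j; rewrite inE => /predU1P[->|/allPs].
by move=> allP; split=> [|j js]; apply: allP; rewrite inE ?eqxx // js orbT.
Qed.

Lemma definable_exists_fin (I : finType) V (P : I -> forall M, (V -> M) -> Prop) :
  (forall i, definable (P i)) -> definable (fun M v => exists i, P i M v).
Proof.
move=> dP; apply: definable_ext (definable_not (definable_forall_fin
  (fun i => definable_not (dP i)))) => M v; split=> [notall|[i Pi] /(_ i)//].
by apply: contrapT => none; apply: notall => i Pi; apply: none; exists i.
Qed.

Lemma definable_ex_tuple (m : nat) W (P : forall M, ('I_m + W -> M) -> Prop) :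
  definable P -> definable (fun M v => exists a : 'I_m -> M, P M (join a v)).
Proof.
elim: m W P => [|m IH] W P dP.
  pose s (x : 'I_0 + W) : W :=
    match x with inl i => match notF (valP i) with end | inr w => w end.
  apply: definable_ext (definable_rename s dP) => M v.
  have joinE a : v \o s = join a v by apply/funext=> -[[]|].
  by split=> [Pv|[a]]; [exists (fun i => v (s (inl i))) |]; rewrite -joinE.
pose s (x : 'I_m.+1 + W) : 'I_m + option W :=
  match x with
  | inl i => if unlift ord0 i is Some j then inl j else inr None
  | inr w => inr (Some w)
  end.
apply: definable_ext (definable_ex (IH _ _ (definable_rename s dP))) => M v.
split=> [[x [a Pxa]]|[a Pa]].
  exists (fun i => if unlift ord0 i is Some j then a j else x).
  by congr (P M _): Pxa; apply/funext=> -[i|w] //=; case: unliftP.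
exists (a ord0), (fun j => a (lift ord0 j)).
by congr (P M _): Pa; apply/funext=> -[i|w] //=; case: unliftP => [j|] ->.
Qed.

Lemma elementary_definable (I : finType) M D (e : M -> D)
    (P : forall M, (I -> M) -> Prop) (v : I -> M) :
  elementary_embedding e -> definable P -> P M v <-> P D (e \o v).
Proof.
move=> ee [chi chiP]; rewrite -!chiP.
have rankE (X : structure L) (w : I -> X) : (w \o enum_val) \o enum_rank = w.
  by apply/funext=> i /=; rewrite enum_rankK.
have := ee _ (rename (@enum_rank I) chi) (v \o enum_val).
by rewrite !sat_rename rankE -[e \o _]/((e \o v) \o enum_val) rankE.
Qed.

End Definability.

Local Notation profile_type I := {set {ffun option I -> bool}}.

Section Realizability.
Variables (L : language) (m n : nat) (phi : formula L ('I_m + 'I_n)).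
Implicit Types (I : finType) (M D : structure L).

Definition truth M (a : 'I_m -> M) (y : 'I_n -> M) : bool := `[<sat phi (join a y)>].

Definition realizable M (I : Type) (x : I -> bool) (w : I -> 'I_n -> M) : Prop :=
  exists a : 'I_m -> M, forall i, truth a (w i) = x i.

Lemma definable_realizable I V (x : I -> bool) (s : I -> 'I_n -> V) :
  definable (fun M (v : V -> M) => realizable x (fun i => v \o s i)).
Proof.
apply: (@definable_ex_tuple L m V (fun M u =>
  forall i, truth (u \o inl) (u \o inr \o s i) = x i)).
apply: definable_forall_fin => i.
pose t (z : 'I_m + 'I_n) : 'I_m + V :=
  match z with inl j => inl j | inr l => inr (s i l) end.
have := definable_iff (definable_rename t (definable_sat phi)) (definable_bool L _ (x i)).
apply: definable_ext => M u; rewrite /truth.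
have -> : u \o t = join (u \o inl) (u \o inr \o s i) by apply/funext; case.
by split=> [satx|<-]; [apply/asboolP/idP; rewrite satx | rewrite asboolE].
Qed.

Lemma realizable_elementary I M D (e : M -> D) (x : I -> bool) (w : I -> 'I_n -> M) :
  elementary_embedding e -> realizable x w <-> realizable x (fun i => e \o w i).
Proof.
move=> ee; exact: (elementary_definable (fun z => w z.1 z.2) ee
  (definable_realizable x (fun i l => (i, l)))).
Qed.

Definition profile I M (c : I -> 'I_n -> M) (y : 'I_n -> M) : profile_type I :=
  [set x : {ffun option I -> bool} | `[<realizable x (oapp c y)>]]%SET.

Lemma definable_profile_eq I V (s : I -> 'I_n -> V) (t : 'I_n -> V) Q :
  definable (fun M (v : V -> M) => profile (fun i => v \o s i) (v \o t) = Q).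
Proof.
have := definable_forall_fin (fun x : {ffun option I -> bool} =>
  definable_iff (definable_realizable x (oapp s t)) (definable_bool L _ (x \in Q))).
apply: definable_ext => M v.
have -> : (fun o => v \o oapp s t o) = oapp (fun i => v \o s i) (v \o t).
  by apply/funext; case.
split=> [xQ|<- x]; last by rewrite inE asboolE.
by apply/setP=> x; rewrite inE; apply/asboolP/idP=> /xQ.
Qed.

(* Apart from the points [c], the decoder has one parameter for each profile and
   a reference parameter: a profile is decoded as true iff its parameter equals
   the reference. *)
Definition decoder I M (w : I + option (profile_type I) -> 'I_n -> M)
    (y : 'I_n -> M) : Prop :=
  w (inr (Some (profile (w \o inl) y))) = w (inr None).

Lemma definable_decoder I :
  definable (fun M (v : 'I_n + (I + option (profile_type I)) * 'I_n -> M) =>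
    decoder (fun j l => v (inr (j, l))) (v \o inl)).
Proof.
pose s (j : I + option (profile_type I)) (l : 'I_n) :
  'I_n + (I + option (profile_type I)) * 'I_n := inr (j, l).
have := definable_exists_fin (fun Q => definable_and
  (definable_profile_eq (s \o inl) inl Q)
  (definable_forall_fin (fun l => definable_eq L (s (inr (Some Q)) l) (s (inr None) l)))).
apply: definable_ext => M v; split=> [[Q [profQ /funext wQ]]|wE].
  by rewrite /decoder -wQ -profQ.
by exists (profile (fun j l => v (inr (inl j, l))) (v \o inl)); split=> // l;
  move/funeqP: wE => /(_ l).
Qed.

End Realizability.

Local Open Scope classical_set_scope.
Local Open Scope card_scope.

Lemma finite_set_enum (X : Type) (B : set X) : finite_set B ->
  exists (q : nat) (b : 'I_q -> X), injective b /\ B = range b.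
Proof.
case/finite_setP=> q /card_eq_trans/(_ card_II); rewrite card_eq_sym.
case/card_bijP=> f [g fK gK]; exists q, (fun i => val (f (to_setT i))); split.
  by move=> i j /val_inj/(can_inj fK)/(congr1 val).
apply/seteqP; split=> [x Bx|_ [i _ <-]]; last exact: set_valP.
set y := SigSub (mem_set Bx); exists (val (g y)) => //.
by have -> : to_setT (val (g y)) = g y; [apply: val_inj | rewrite gK].
Qed.

Lemma card_eq_finset (T : finType) (A : {set T}) : [set` A] #= `I_#|A|.
Proof.
have -> : [set` A] = range (@enum_val _ (mem A)).
  apply/seteqP; split=> [x Ax|_ [i _ <-]]; last exact: enum_valP.
  by exists (enum_rank_in Ax x) => //; apply: enum_rankK_in.
apply: card_eq_trans (inj_card_eq (in2W enum_val_inj)) _.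
by rewrite card_eq_sym card_II.
Qed.

Lemma card_ge2_neq (X : Type) (B : set X) : `I_2 #<= B ->
  exists x y, [/\ B x, B y & x <> y].
Proof.
case/card_leP=> f; pose pt i (i2 : (i < 2)%N) := val (f (SigSub (mem_set (i2 : `I_2 i)))).
exists (pt 0 isT), (pt 1 isT); split; try exact: set_valP.
by move/val_inj/inj; rewrite !inE => /(_ I I)/(congr1 val).
Qed.

Section PhiTypes.
Variables (L : language) (C : structure L) (m n : nat).
Variable phi : formula L ('I_m + 'I_n).
Implicit Types (B : set (n.-tuple C)) (p : set (formula L ('I_m + C))).

Lemma sat_phi_at (D : structure L) (e : C -> D) (a : 'I_m -> D) (b : n.-tuple C) :
  sat (phi_at phi b) (join a e) <-> sat phi (join a (e \o tnth b)).
Proof.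
rewrite sat_rename; have -> // : join a e \o join inl (inr \o tnth b) =
  join a (e \o tnth b) by apply/funext; case.
Qed.

Definition type_of B (a : 'I_m -> C) : set (formula L ('I_m + C)) :=
  [set chi | phi_formulas phi B chi /\ sat chi (join a id)].

Lemma type_of_phi_at B a b : B b -> `[<type_of B a (phi_at phi b)>] = truth phi a (tnth b).
Proof.
move=> Bb; apply: asbool_equiv_eq; rewrite -(sat_phi_at id); split=> [[]//|satb].
by split=> //; exists b; split=> //; left.
Qed.

Lemma phi_types_type_of B a : phi_types phi B (type_of B a).
Proof.
split=> [chi []//||q qB [D [e [d [ee dq]]]] tq].
  by exists C, id, a; split=> // chi [].
apply/seteqP; split=> // chi qchi; split; first exact: qB.
apply: contrapT => not_chi; have [b [Bb [chiE|chiE]]] := qB _ qchi.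
  have /tq/dq : type_of B a (Not chi).
    by split=> //; exists b; split=> //; right; rewrite chiE.
  by apply; apply: dq.
have sat_b : sat (phi_at phi b) (join a id).
  by apply: contrapT => not_sat; apply: not_chi; rewrite chiE.
have /tq/dq : type_of B a (phi_at phi b) by split=> //; exists b; split=> //; left.
by have := dq _ qchi; rewrite chiE.
Qed.

Lemma phi_types_realizable (I : finType) (b : I -> n.-tuple C) B p :
  (forall i, B (b i)) -> phi_types phi B p ->
  realizable phi (fun i => `[<p (phi_at phi (b i))>]) (fun i => tnth (b i)).
Proof.
move=> Bb [pB [D [e [d [ee dp]]]] maxp]; apply/(realizable_elementary _ _ _ ee).
exists d => i; apply: asbool_equiv_eq; rewrite -sat_phi_at; split=> [sd|/dp//].
pose r := [set chi | phi_formulas phi B chi /\ sat chi (join d e)].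
have <- : r = p.
  apply: maxp => [chi []//||chi pchi]; first by exists D, e, d; split=> // chi [].
  by split; [apply: pB | apply: dp].
by split=> //; exists (b i); split=> //; left.
Qed.

Lemma UDTFS_definable (I : finType)
    (P : forall M : structure L, (I -> 'I_n -> M) -> ('I_n -> M) -> Prop) :
  definable (fun M v => P M (fun i l => v (inr (i, l))) (v \o inl)) ->
  (forall B, finite_set B -> `I_2 #<= B -> forall p, phi_types phi B p ->
     exists c : I -> n.-tuple C, (forall i, B (c i)) /\
       forall b, B b -> P C (fun i => tnth (c i)) (tnth b) <-> p (phi_at phi b)) ->
  UDTFS C phi.
Proof.
pose s (x : 'I_n + I * 'I_n) : 'I_n + 'I_#|I| * 'I_n :=
  match x with inl l => inl l | inr (i, l) => inr (enum_rank i, l) end.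
move=> /(definable_rename s)[psi psiP] defP; exists #|I|, psi => B finB Bge2 p pB.
have [c [Bc cP]] := defP B finB Bge2 p pB.
exists (c \o enum_val); split=> [k|b Bb]; first exact: Bc.
rewrite psiP -cP //=; have -> // :
  (fun i l => tnth (c (enum_val (enum_rank i))) l) = (fun i => tnth (c i)).
by apply/funext=> i; rewrite enum_rankK.
Qed.

Definition point_profile (I : finType) (c : I -> n.-tuple C) (b : n.-tuple C) :
    profile_type I :=
  profile phi (fun i => tnth (c i)) (tnth b).

Definition determined_by_profiles (I : finType) : Prop :=
  forall B, finite_set B -> `I_2 #<= B -> forall p, phi_types phi B p ->
  exists c : I -> n.-tuple C, (forall i, B (c i)) /\
    forall b b', B b -> B b' -> point_profile c b = point_profile c b' ->
      p (phi_at phi b) -> p (phi_at phi b').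

Lemma UDTFS_of_profiles (I : finType) : determined_by_profiles I -> UDTFS C phi.
Proof.
move=> determined; apply: (UDTFS_definable (definable_decoder phi I)) => B finB Bge2 p pB.
have [c [Bc same_profile]] := determined B finB Bge2 p pB.
have [b0 [b1 [Bb0 Bb1 b01]]] := card_ge2_neq Bge2.
pose value Q := `[<exists b, [/\ B b, point_profile c b = Q & p (phi_at phi b)]>].
exists (fun j => match j with
  | inl i => c i
  | inr (Some Q) => if value Q then b0 else b1
  | inr None => b0
  end); split=> [[i|[Q|]]|b Bb] //; first by case: ifP.
rewrite /decoder -/(point_profile c b).
have -> : p (phi_at phi b) <-> value (point_profile c b).
  split=> [pb|/asboolP[b' [Bb' prof_b' pb']]]; last exact: same_profile prof_b' pb'.
  by apply/asboolP; exists b.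
case: (value _) => //; split=> // b10; case: b01.
by apply: eq_from_tnth => l; rewrite b10.
Qed.

Section Flips.
Variables (T : finType) (b : T -> n.-tuple C) (sgn : T -> bool).

Definition flips : {set {set T}} :=
  [set f : {set T} | `[<realizable phi (fun i => (i \in f) (+) sgn i)
                                   (fun i => tnth (b i))>]]%SET.

Lemma flipsP (f : {set T}) :
  reflect (exists a, forall i, truth phi a (tnth (b i)) = (i \in f) (+) sgn i)
          (f \in flips).
Proof. by rewrite inE; apply: asboolP. Qed.

Lemma card_traces_flips (A : {set T}) (k : nat) :
  injective b ->
  (forall B, B #= `I_#|A| -> phi_types phi B #<= `I_k) ->
  (#|traces flips A| <= k)%N.
Proof.
move=> b_inj bound.
have realize (t : {set T}) : exists a : 'I_m -> C, t \in traces flips A ->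
    {in A, forall i, truth phi a (tnth (b i)) = (i \in t) (+) sgn i}.
  have [/imsetP[f /flipsP[a fa] ->]|_] := boolP (t \in _); last first.
    by have [x] := carrier_inhabited C; exists (fun _ => x).
  by exists a => _ i iA; rewrite fa inE iA andbT.
have [a aP] := fin_all_exists realize.
pose B := b @` [set` A]; pose type t := type_of B (a t).
have type_inj : {in [set` traces flips A] &, injective type}.
  move=> t u; rewrite !inE => tA uA tu; apply/setP=> i.
  have [iA|iA] := boolP (i \in A); last first.
    by move: tA uA => /imsetP[f _ ->] /imsetP[g _ ->]; rewrite !inE (negbTE iA) !andbF.
  apply: (@addIb (sgn i)); rewrite -!aP //.
  have Bbi : B (b i) by exists i.
  by rewrite -!(type_of_phi_at _ Bbi) -/(type t) tu.
rewrite -card_le_II; apply: card_le_trans (bound B _); last first.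
  exact: card_eq_trans (inj_card_eq (in2W b_inj)) (card_eq_finset A).
rewrite -(card_le_eql (card_eq_finset _)) -(card_le_eql (inj_card_eq type_inj)).
by apply: subset_card_le => _ [t _ <-]; apply: phi_types_type_of.
Qed.

Lemma enforces_flips (I : finType) (c : I -> T) (Y : {set T}) i j :
  {in Y, forall y, exists k, y = c k} -> sgn i != sgn j ->
  point_profile (b \o c) (b i) = point_profile (b \o c) (b j) ->
  enforces flips Y i j.
Proof.
move=> cY sgn_ij prof_ij; apply/enforcesP=> f /flipsP[a fa] /negbTE fi.
pose x := [ffun o => truth phi a (tnth (b (oapp c i o)))].
have : x \in point_profile (b \o c) (b i).
  by rewrite inE; apply/asboolP; exists a => -[k|]; rewrite ffunE.
rewrite prof_ij inE => /asboolP[a' a'x].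
exists [set l | truth phi a' (tnth (b l)) (+) sgn l]%SET.
  by apply/flipsP; exists a' => l; rewrite inE addbK.
split; last by rewrite inE (a'x None) ffunE /= fa fi; case: (sgn i) sgn_ij; case: (sgn j).
apply/setP=> l; rewrite !inE; case lY: (l \in Y); rewrite ?andbF // !andbT.
by have [k ->] := cY l lY; rewrite (a'x (Some k)) ffunE /= fa addbK.
Qed.

Lemma antitwins_flips (I : finType) (c : I -> T) (Y : {set T}) i j :
  {in Y, forall y, exists k, y = c k} -> sgn i != sgn j ->
  point_profile (b \o c) (b i) = point_profile (b \o c) (b j) ->
  antitwins flips Y i j.
Proof.
by move=> cY sgn_ij prof_ij; rewrite /antitwins !(enforces_flips cY) // eq_sym.
Qed.

End Flips.
End PhiTypes.

Lemma exists_determining_profiles (L : language) (C : structure L) (m n : nat)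
    (phi : formula L ('I_m + 'I_n)) (N : nat) :
  (forall B : set (n.-tuple C), B #= `I_N -> phi_types phi B #<= `I_('C(N.+1, 2))) ->
  exists K : nat, determined_by_profiles C phi 'I_K.
Proof.
move=> bound; have [K antitwin_free] := bounded_antitwin_free N.
exists K => _ /finite_set_enum[q [b [b_inj ->]]] /card_ge2_neq[_ [_ [[i0 _ _] _ _]]] p pB.
have Bb i : range b (b i) by exists i.
pose sgn i := `[<p (phi_at phi (b i))>].
have flips0 : finset.set0 \in flips phi b sgn.
  have [a a_p] := phi_types_realizable Bb pB.
  by apply/flipsP; exists a => i; rewrite a_p inE.
have [Y YK Y_free] : exists2 Y : {set 'I_q},
    (#|Y| <= K)%N & antitwinned (flips phi b sgn) Y = finset.set0.
  apply: antitwin_free => // A AN; apply: card_traces_flips => // B.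
  by rewrite AN; apply: bound.
have [c cY] := cover_by_tuple i0 YK.
exists (b \o c); split=> [k|_ _ [i _ <-] [j _ <-] prof_ij]; first exact: Bb.
suff sgn_ij : sgn i = sgn j by move=> /asboolP; rewrite -/(sgn i) sgn_ij => /asboolP.
apply: contra_eq (Y_free) => sgn_ij; apply/finset.set0Pn; exists i; rewrite inE.
by apply/existsP; exists j; apply: antitwins_flips cY sgn_ij prof_ij.
Qed.

Theorem theorem3p14 (L : language) (T : set (sentence L)) (kappa : Type)
    (C : structure L) (hT : complete_theory T)
    (hC : monster_model kappa T C) (m n : nat)
    (phi : formula L ('I_m + 'I_n)) (N : nat) (hN : (0 < N)%N)
    (hphi : forall B : set (n.-tuple C), B #= `I_N ->
       phi_types phi B #<= `I_((N * (N + 1)) %/ 2)) :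
  UDTFS C phi.
Proof.
have binN : (N * (N + 1)) %/ 2 = 'C(N.+1, 2) by rewrite bin2 /= addn1 mulnC divn2.
rewrite binN in hphi; have [K determined] := exists_determining_profiles hphi.
exact: UDTFS_of_profiles determined.
Qed.
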